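(* Let $X$ be $\mathbb{R}^d$, or a complete Riemannian manifold (not necessarily finite-dimensional), or a Banach space, let $U\subseteq X$ be open and convex, and let $k\in\mathbb{N}\cup\{\infty\}$. Assume that $U=\bigcup_{n=1}^{\infty}B_n$, where the $B_n$ are open bounded convex sets such that $\mathrm{dist}(B_n,\partial U)>0$ and $\overline{B_n}\subset B_{n+1}$ for each $n$. Assume also that every continuous convex function $f:U\to\mathbb{R}$ can be approximated from below by $C^k$ convex (resp. strongly convex) functions, uniformly on bounded subsets of $U$. Then every continuous convex function $f:U\to\mathbb{R}$ can be approximated from below by $C^k$ convex (resp. strongly convex) functions, uniformly on $U$; that is, for every $\varepsilon>0$ there exists a $C^k$ convex (resp. strongly convex) function $g:U\to\mathbb{R}$ such that $f-\varepsilon\leq g\leq f$ on $U$.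
   Context: Approximation from below, uniformly on bounded subsets: a continuous convex function $f:U\to\mathbb{R}$ can be approximated from below by $C^k$ convex (resp. strongly convex) functions, uniformly on bounded subsets of $U$, if for every bounded set $B$ with $\overline{B}\subset U$ and $\mathrm{dist}(B,\partial U)>0$, and for every $\varepsilon>0$, there exists a $C^k$ convex (resp. strongly convex) function $g:U\to\mathbb{R}$ such that $g\leq f$ on $U$ and $f-\varepsilon\leq g$ on $B$. When $U=X$, one uses the convention $\mathrm{dist}(B,\partial U)=\infty$ for every bounded $B\subset X$. In the Riemannian case, convexity of sets and functions is geodesic convexity. Strong convexity: a $C^2$ function $\varphi$ is strongly convex if its second derivative along any nonconstant geodesic (nonconstant straight line, in the case of $\mathbb{R}^d$ or of a Banach space) is strictly positive everywhere on the geodesic. A not necessarily smooth function $f$ is strongly convex if every point $p$ of its domain has an open neighbourhood $V$ for which there is a strongly convex function $\varphi\in C^2(V)$ such that $f-\varphi$ is convex on $V$. *)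

(* Defs.v *)
From HB Require Import structures.
From mathcomp Require Import all_boot all_order all_algebra.
From mathcomp Require Import all_classical all_reals all_analysis.

Set Implicit Arguments.
Unset Strict Implicit.
Unset Printing Implicit Defensive.

Import Order.TTheory GRing.Theory Num.Theory.
Import numFieldNormedType.Exports.

Local Open Scope ring_scope.
Local Open Scope classical_set_scope.

(** * Continuous linear maps with the operator norm *)

Record clin (R : realType) (E F : normedModType R) := CLin {
  clin_fun :> E -> F;
  clin_linear : linear clin_fun;
  clin_continuous : continuous clin_fun }.

Section OperatorNorm.
Context {R : realType} {E F : normedModType R}.
Implicit Types f g h : clin E F.

HB.instance Definition _ f :=
  GRing.isLinear.Build R E F *:%R f (@clin_linear R E F f).

HB.instance Definition _ := gen_eqMixin (clin E F).
HB.instance Definition _ := gen_choiceMixin (clin E F).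

Lemma clinP f g : (forall x, f x = g x) -> f = g.
Proof.
case: f g => [f lf cf] [g lg cg] /= /funext fg; subst g.
by rewrite (Prop_irrelevance lf lg) (Prop_irrelevance cf cg).
Qed.

Fact clin_zero_linear : linear ((fun=> 0) : E -> F).
Proof. by move=> a x y; rewrite scaler0 addr0. Qed.

Fact clin_zero_continuous : continuous ((fun=> 0) : E -> F).
Proof. by move=> x; exact: cvg_cst. Qed.

Definition clin_zero : clin E F := CLin clin_zero_linear clin_zero_continuous.

Fact clin_add_linear f g : linear ((fun x => f x + g x) : E -> F).
Proof. by move=> a x y; rewrite !linearP scalerDr addrACA. Qed.

Fact clin_add_continuous f g : continuous ((fun x => f x + g x) : E -> F).
Proof. by move=> x; apply: cvgD; [exact: (@clin_continuous _ _ _ f)|exact: (@clin_continuous _ _ _ g)]. Qed.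

Definition clin_add f g : clin E F :=
  CLin (clin_add_linear f g) (@clin_add_continuous f g).

Fact clin_scale_linear (a : R) f : linear ((fun x => a *: f x) : E -> F).
Proof. by move=> b x y; rewrite linearP scalerDr !scalerA mulrC. Qed.

Fact clin_scale_continuous (a : R) f : continuous ((fun x => a *: f x) : E -> F).
Proof. by move=> x; apply: cvgZl_tmp; exact: (@clin_continuous _ _ _ f). Qed.

Definition clin_scale (a : R) f : clin E F :=
  CLin (clin_scale_linear a f) (@clin_scale_continuous a f).

Definition clin_opp f : clin E F := clin_scale (-1) f.

Fact clin_addA : associative clin_add.
Proof. by move=> f g h; apply/clinP => x /=; rewrite addrA. Qed.

Fact clin_addC : commutative clin_add.
Proof. by move=> f g; apply/clinP => x /=; rewrite addrC. Qed.

Fact clin_add0 : left_id clin_zero clin_add.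
Proof. by move=> f; apply/clinP => x /=; rewrite add0r. Qed.

Fact clin_addN : left_inverse clin_zero clin_opp clin_add.
Proof. by move=> f; apply/clinP => x /=; rewrite scaleN1r addNr. Qed.

HB.instance Definition _ := GRing.isZmodule.Build (clin E F)
  clin_addA clin_addC clin_add0 clin_addN.

Fact clin_scaleA a b f : clin_scale a (clin_scale b f) = clin_scale (a * b) f.
Proof. by apply/clinP => x /=; rewrite scalerA. Qed.

Fact clin_scale1 : left_id 1 clin_scale.
Proof. by move=> f; apply/clinP => x /=; rewrite scale1r. Qed.

Fact clin_scaleDr : right_distributive clin_scale +%R.
Proof. by move=> a f g; apply/clinP => x /=; rewrite scalerDr. Qed.

Fact clin_scaleDl f : {morph clin_scale^~ f : a b / a + b}.
Proof. by move=> a b; apply/clinP => x /=; rewrite scalerDl. Qed.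

HB.instance Definition _ := GRing.Zmodule_isLmodule.Build R (clin E F)
  clin_scaleA clin_scale1 clin_scaleDr clin_scaleDl.

Definition opnorm f : R := sup [set `|f x| | x in [set x | `|x| <= 1]].

Lemma opnorm_has_sup f : has_sup [set `|f x| | x in [set x | `|x| <= 1]].
Proof.
split; first by exists `|f 0|; exists 0 => //=; rewrite normr0.
have /bounded_funP/(_ 1)[M fM] := continuous_linear_bounded 0
  (f := f : {linear E -> F}) (@clin_continuous _ _ _ f 0).
by exists M => _ [x /= x1 <-]; exact: fM.
Qed.

Lemma opnorm_ub f x : `|x| <= 1 -> `|f x| <= opnorm f.
Proof. by move=> x1; apply: (ub_le_sup (opnorm_has_sup f).2); exists x. Qed.

Lemma opnorm_le f M : (forall x, `|x| <= 1 -> `|f x| <= M) -> opnorm f <= M.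
Proof.
move=> fM; apply: ge_sup; first exact: (opnorm_has_sup f).1.
by move=> _ [x x1 <-]; exact: fM.
Qed.

Fact opnormD f g : opnorm (f + g) <= opnorm f + opnorm g.
Proof.
apply: opnorm_le => x x1.
by rewrite (le_trans (ler_normD _ _)) // lerD // opnorm_ub.
Qed.

Fact opnormZ (a : R) f : opnorm (a *: f) = `|a| * opnorm f.
Proof.
have le b h : opnorm (b *: h) <= `|b| * opnorm h.
  by apply: opnorm_le => x x1; rewrite normrZ ler_wpM2l // opnorm_ub.
apply/eqP; rewrite eq_le le /=.
have [->|a0] := eqVneq a 0.
  rewrite normr0 mul0r; apply: le_trans (opnorm_ub (0 *: f) (x := 0) _) => //.
  by rewrite normr0.
rewrite -ler_pdivlMl ?normr_gt0 // -normfV.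
by rewrite -{1}[f](scale1r) -(mulVf a0) -scalerA le.
Qed.

Fact opnorm_eq0 f : opnorm f = 0 -> f = 0.
Proof.
move=> f0; apply/clinP => x; apply/eqP; rewrite -normr_eq0.
have [->|x0] := eqVneq x 0; first by rewrite linear0 normr0.
have nx0 : `|x| != 0 by rewrite normr_eq0.
have : `|f (`|x|^-1 *: x)| <= 0.
  by rewrite -f0 opnorm_ub // normrZ normfV normr_id mulVf.
rewrite linearZ /= normrZ normfV normr_id pmulr_rle0 ?normr_le0 ?normr_eq0 //.
by rewrite invr_gt0 normr_gt0.
Qed.

HB.instance Definition _ :=
  Lmodule_isNormed.Build R (clin E F) opnormD opnormZ opnorm_eq0.

End OperatorNorm.

(** * Maps of class C^k *)

Inductive smoothness := Cfin of nat | Cinfty.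

(** Both are meant for [U] open. *)
Fixpoint Cn (R : realType) (n : nat) (E F : normedModType R)
    (U : set E) (f : E -> F) : Prop :=
  match n with
  | 0 => forall x, U x -> {for x, continuous f}
  | n.+1 => exists f' : E -> clin E F,
      (forall x, U x -> is_diff x f (f' x)) /\ Cn n U f'
  end.

Definition Ck (R : realType) (k : smoothness) (E F : normedModType R)
    (U : set E) (f : E -> F) : Prop :=
  match k with
  | Cfin n => Cn n U f
  | Cinfty => forall n, Cn n U f
  end.

(** * Riemannian manifolds *)

(** The model space is only assumed to be a Banach space: wherever it is used,
    [rm_coercive] makes its norm equivalent to the Hilbert norm given by the
    metric.  [rm_metric i p] is the metric at the point of coordinates [p] in
    the chart [i]; [rm_chartV i] is relevant on the range of the chart only. *)
Record riemannian (R : realType) := Riemannian {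
  rm_model : completeNormedModType R;
  rm_carrier : topologicalType;
  rm_hausdorff : hausdorff_space rm_carrier;
  rm_index : Type;
  rm_dom : rm_index -> set rm_carrier;
  rm_chart : rm_index -> rm_carrier -> rm_model;
  rm_chartV : rm_index -> rm_model -> rm_carrier;
  rm_chart_at : rm_carrier -> rm_index;
  rm_dom_open : forall i, open (rm_dom i);
  rm_dom_at : forall x, rm_dom (rm_chart_at x) x;
  rm_range_open : forall i, open (rm_chart i @` rm_dom i);
  rm_chartK : forall i x, rm_dom i x -> rm_chartV i (rm_chart i x) = x;
  rm_chart_continuous : forall i x, rm_dom i x ->
    {for x, continuous (rm_chart i)};
  rm_chartV_continuous : forall i x, rm_dom i x ->
    {for rm_chart i x, continuous (rm_chartV i)};
  rm_transition : forall i j,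
    Ck Cinfty (rm_chart i @` (rm_dom i `&` rm_dom j))
       (rm_chart j \o rm_chartV i);
  rm_metric : rm_index -> rm_model -> clin rm_model (clin rm_model R^o);
  rm_metric_smooth : forall i,
    Ck Cinfty (rm_chart i @` rm_dom i) (rm_metric i);
  rm_metric_sym : forall i x, rm_dom i x -> forall u v,
    rm_metric i (rm_chart i x) u v = rm_metric i (rm_chart i x) v u;
  rm_coercive : forall i x, rm_dom i x -> exists2 c : R, 0 < c &
    forall v, c * `|v| ^+ 2 <= rm_metric i (rm_chart i x) v v;
  rm_metric_compat : forall i j x, rm_dom i x -> rm_dom j x -> forall u v,
    let D := 'd (rm_chart j \o rm_chartV i) (rm_chart i x) in
    rm_metric j (rm_chart j x) (D u) (D v) = rm_metric i (rm_chart i x) u v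
}.

Section Riemannian.
Context {R : realType} (M : riemannian R).
Notation car := (rm_carrier M).
Notation H := (rm_model M).

Definition rm_Ck (k : smoothness) (U : set car) (f : car -> R) : Prop :=
  forall i, Ck k (@rm_chart R M i @` (@rm_dom R M i `&` U))
               ((f \o @rm_chartV R M i) : H -> R^o).

Definition rm_Ck_curve (k : smoothness) (J : set R) (c : R -> car) : Prop :=
  (forall t, J t -> {for t, continuous c}) /\
  forall i, Ck k (J `&` c @^-1` (@rm_dom R M i))
              ((@rm_chart R M i \o c) : R^o -> H).

Definition rm_speed (c : R -> car) (t : R) : R :=
  let i := rm_chart_at (c t) in
  let x : R -> H := @rm_chart R M i \o c in
  Num.sqrt (rm_metric i (x t) (x^`() t) (x^`() t)).

(** [s] lists the break points. *)
Definition rm_piecewise_C1 (c : R -> car) : Prop :=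
  exists s : seq R, forall a b : R, 0 <= a -> a < b -> b <= 1 ->
    (forall t, t \in s -> ~ (a < t < b)) ->
    exists (J : set R) (e : R -> car),
      [/\ open J, `[a, b] `<=` J, rm_Ck_curve (Cfin 1) J e
        & forall t, `[a, b] t -> c t = e t].

Definition rm_length (c : R -> car) : \bar R :=
  (\int[lebesgue_measure]_(t in `[0%R, 1%R]) (rm_speed c t)%:E)%E.

(** Infinite between different connected components. *)
Definition rm_dist (x y : car) : \bar R :=
  ereal_inf [set rm_length c | c in
    [set c | [/\ rm_piecewise_C1 c, c 0 = x & c 1 = y]]].

Definition rm_complete : Prop :=
  forall u : nat -> car,
    (forall e : R, 0 < e -> exists N, forall m n, (N <= m)%N -> (N <= n)%N ->
      (rm_dist (u m) (u n) < e%:E)%E) ->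
    exists x, forall e : R, 0 < e -> exists N, forall n, (N <= n)%N ->
      (rm_dist (u n) x < e%:E)%E.

(** Christoffel symbol of the first kind of the Levi-Civita connection: the
    vector [Gamma p u v] is determined by
    [rm_metric i p (Gamma p u v) w = rm_christoffel i p u v w] for all [w]. *)
Definition rm_christoffel (i : rm_index M) (p u v w : H) : R :=
  let dg (h : H) : clin H (clin H R^o) := 'd (@rm_metric R M i) p h in
  (dg u v w + dg v u w - dg w u v) / 2.

(** The equation x'' + Gamma(x)(x', x') = 0 in every chart, paired with an
    arbitrary vector [w]. *)
Definition rm_geodesic (a b : R) (c : R -> car) : Prop :=
  rm_Ck_curve (Cfin 2) `]a, b[ c /\
  forall i t, `]a, b[ t -> rm_dom i (c t) ->
    let x : R -> H := @rm_chart R M i \o c in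
    forall w : H,
      rm_metric i (x t) (x^`(2) t) w
      + rm_christoffel i (x t) (x^`() t) (x^`() t) w = 0.

End Riemannian.

(** * The spaces under consideration *)

(** [sp_geodesic a b c]: the restriction of [c] to the open interval ]a, b[ is
    a geodesic (an affinely parametrized straight line in the linear case). *)
Record space (R : realType) := Space {
  sp_carrier :> topologicalType;
  sp_dist : sp_carrier -> sp_carrier -> \bar R;
  sp_geodesic : R -> R -> (R -> sp_carrier) -> Prop;
  sp_Ck : smoothness -> set sp_carrier -> (sp_carrier -> R) -> Prop
}.

Definition linear_geodesic (R : realType) (V : normedModType R) (a b : R)
    (c : R -> V) : Prop :=
  exists x v : V, forall t, `]a, b[ t -> c t = x + t *: v.

(** The library norm on ['rV[R]_d] is the max norm; only the distance depends
    on this choice. *)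
Definition euclidean_dist (R : realType) (d : nat) (x y : 'rV[R]_d) : R :=
  Num.sqrt (\sum_(i < d) (x 0 i - y 0 i) ^+ 2).

Definition euclidean_space (R : realType) (d : nat) : space R :=
  @Space R 'rV[R]_d (fun x y => (euclidean_dist x y)%:E)
    (@linear_geodesic R 'rV[R]_d) (fun k U f => @Ck R k 'rV[R]_d R^o U f).

Definition banach_space (R : realType) (E : completeNormedModType R) : space R :=
  @Space R E (fun x y => `|x - y|%:E)
    (@linear_geodesic R E) (fun k U f => @Ck R k E R^o U f).

Definition riemannian_space (R : realType) (M : riemannian R) : space R :=
  @Space R (rm_carrier M) (@rm_dist R M) (@rm_geodesic R M) (@rm_Ck R M).

Inductive ambient (R : realType) :=
| Euclidean of nat
| CompleteRiemannian (M : riemannian R) of rm_complete M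
| Banach of completeNormedModType R.

Definition space_of (R : realType) (X : ambient R) : space R :=
  match X with
  | Euclidean d => euclidean_space R d
  | CompleteRiemannian M _ => riemannian_space M
  | Banach E => banach_space E
  end.

Coercion space_of : ambient >-> space.

Section Convexity.
Context {R : realType} {X : space R}.
Implicit Types (U V C A B : set X) (f g phi : X -> R) (c : R -> X).

Definition gconvex_set C : Prop :=
  forall x y, C x -> C y -> exists a b c,
    [/\ a < 0, 1 < b, sp_geodesic a b c, c 0 = x & c 1 = y] /\
    (forall t, `[0, 1] t -> C (c t)).

Definition geodesic_in U (a b : R) c : Prop :=
  sp_geodesic a b c /\ (forall t, `]a, b[ t -> U (c t)).

(** For [U] open, not necessarily convex. *)
Definition gconvex_fun U f : Prop :=
  forall a b c, geodesic_in U a b c ->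
    @convex_function R R^o `]a, b[ (f \o c).

Definition strongly_convex_C2 U phi : Prop :=
  sp_Ck (Cfin 2) U phi /\
  forall a b c, geodesic_in U a b c ->
    (exists s t, [/\ `]a, b[ s, `]a, b[ t & c s <> c t]) ->
    forall t, `]a, b[ t -> 0 < (phi \o c)^`(2) t.

(** For [f] of class C^2 this is equivalent to [strongly_convex_C2 U f]. *)
Definition strongly_convex U f : Prop :=
  forall p, U p -> exists V phi,
    [/\ open V, V p, V `<=` U, strongly_convex_C2 V phi
      & gconvex_fun V (fun x => f x - phi x)].

Definition bounded B : Prop :=
  exists r : R, forall x y, B x -> B y -> (sp_dist x y <= r%:E)%E.

Definition frontier U : set X := closure U `\` interior U.

(** Equal to [+oo] if [A] or [B] is empty. *)
Definition set_dist A B : \bar R :=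
  ereal_inf [set d | exists x y, [/\ A x, B y & d = sp_dist x y]].

Definition Ck_convex (k : smoothness) U g : Prop :=
  sp_Ck k U g /\ gconvex_fun U g.

Definition Ck_strongly_convex (k : smoothness) U g : Prop :=
  sp_Ck k U g /\ strongly_convex U g.

Definition continuous_convex U f : Prop :=
  (forall x, U x -> {for x, continuous f}) /\ gconvex_fun U f.

Definition approx_below_on_bounded (P : set X -> (X -> R) -> Prop) U f : Prop :=
  forall B, bounded B -> closure B `<=` U ->
    (0 < set_dist B (frontier U))%E ->
  forall e : R, 0 < e -> exists g,
    [/\ P U g, forall x, U x -> g x <= f x & forall x, B x -> f x - e <= g x].

Definition approx_below_uniformly (P : set X -> (X -> R) -> Prop) U f : Prop :=
  forall e : R, 0 < e -> exists g,
    P U g /\ forall x, U x -> f x - e <= g x <= f x.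

End Convexity.

(* Main.v *)
From HB Require Import structures.
Require Import Defs.
From mathcomp Require Import all_boot all_order all_algebra.
From mathcomp Require Import all_classical all_reals all_analysis.
From mathcomp Require Import ring lra.
Import Order.TTheory GRing.Theory Num.Theory.
Import numFieldNormedType.Exports.
Local Open Scope ring_scope.
Local Open Scope classical_set_scope.

Set Implicit Arguments.
Unset Strict Implicit.
Unset Printing Implicit Defensive.

(** The approximant is obtained by gluing the approximants that exist on the
    sets [B n] with a smooth substitute for the maximum of two functions.

    Let [soft_pos d t] be [t * expR (- d / t)] for [0 < t] and [0] for
    [t <= 0].  It is smooth and convex, its slope lies in [0, 1[, and
    [t - d <= soft_pos d t <= max 0 t].  Hence
    [soft_max d u v = u + soft_pos d (v - u)] is at most [max u v], at least
    [v - d], and equal to [u] wherever [v <= u].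

    Given [e > 0], take losses [loss 0 < loss 1 < ...] below [e] and build
    [g_n <= f] with [f - loss n <= g_n] on [B n] ([glue_soft_max]).  To pass
    from [n] to [n.+1], the hypothesis applied to [f - loss n] yields some
    [h <= f - loss n] that is within [d] of it on [B n.+1].  On [B n], since
    [h <= f - loss n <= g_n], the function [g_(n+1) = soft_max d g_n h] coincides
    with [g_n], while on [B n.+1] it is at least [h - d], hence at least
    [f - (loss n + 2 d)].  The sequence is stationary near every point, and its
    limit is the required function.

    It remains to see that the class of functions is stable under [soft_max]
    and under such stationary limits.
    - Smoothness of [soft_max]: maps of class C^n between normed spaces are
      stable under continuous bilinear products ([Cn_bilinear]) and under
      composition with [soft_pos d] ([Cn_soft_pos]), by induction on [n].
    - Convexity: let [m] be the slope of [soft_pos d] at [(v - u) z].  The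
      supporting line of [soft_pos d] there shows that [soft_max d u v]
      lies above the convex function [(1 - m) u + m v] up to a constant, with
      equality at [z] ([convex_soft_max]).
    - Strong convexity: near a given point [v - u] is bounded above, so the
      slope [m] stays below some [K < 1]; the same argument shows that
      [soft_max d u v - (1 - K) u] is convex there.  So [soft_max d u v]
      inherits strong convexity from [u] ([strongly_convex_soft_max]).
    - Limits: class C^k and strong convexity are local properties, and an
      instance of the convexity inequality only involves three points, which
      lie in a common [B n].

    The three kinds of spaces enter only through a few closure properties of
    their C^k functions, collected in [smooth_calculus]. *)

(** * Differentials and bounded bilinear maps *)

Section Differentials.
Context {R : realType}.
Implicit Types E F G : normedModType R.

(** The little-o in the definition of the differential, with its epsilon made
    explicit. *)
Lemma is_diff_clinP E F (f : E -> F) (l : clin E F) x :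
  is_diff x f l <-> forall e : R, 0 < e ->
    \forall h \near 0, `|f (h + x) - f x - l h| <= e * `|h|.
Proof.
split=> [[df dl] e e0|H].
  have := diff_locallyx df.
  rewrite dl => /funext /= /eqaddoP /(_ e e0).
  by apply: filterS => h /=; rewrite !fctE opprD addrA.
have Hl : f \o shift x = cst (f x) + l +o_ 0 id.
  apply/eqaddoP => e e0; have := H e e0.
  by apply: filterS => h /=; rewrite !fctE opprD addrA.
have d := diff_unique (@clin_continuous _ _ _ l) Hl.
apply: DiffDef => //; apply/diff_locallyP; rewrite d; split => //.
exact: clin_continuous.
Qed.

(** Differentiability is a local property: this is what lets a map that only
    agrees locally with smooth ones be smooth. *)
Lemma near_eq_is_diff E F (f g : E -> F) (l : clin E F) x :
  {near x, f =1 g} -> is_diff x f l -> is_diff x g l.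
Proof.
move=> fg /is_diff_clinP H; apply/is_diff_clinP => e e0.
have fgx : f x = g x := nbhs_singleton fg.
move: fg; rewrite (near_shift 0 x) => fg.
near=> h; have -> : g (h + x) = f (h + x).
  by near: h; apply: filterS fg => h /=; rewrite subr0.
by rewrite -fgx; near: h; exact: H.
Unshelve. all: by end_near. Qed.

Lemma is_diff_clin_unique E F (f : E -> F) (l m : clin E F) x :
  is_diff x f l -> is_diff x f m -> l = m.
Proof.
by move=> [_ dl] [_ dm]; apply: clinP => y; rewrite -[l y]/((l : E -> F) y) -dl dm.
Qed.

Lemma clin_bound E F (l : clin E F) x : `|l x| <= opnorm l * `|x|.
Proof.
have [->|x0] := eqVneq x 0; first by rewrite linear0 !normr0 mulr0.
have nx0 : 0 < `|x| by rewrite normr_gt0.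
have := @opnorm_ub _ _ _ l (`|x|^-1 *: x).
rewrite linearZ /= !normrZ normfV normr_id mulVf ?gt_eqF// => /(_ (lexx _)).
by rewrite ler_pdivrMl// mulrC.
Qed.

Lemma bounded_linear_clin_continuous E F (f : E -> F) (k : R) :
  linear f -> (forall x, `|f x| <= k * `|x|) -> continuous f.
Proof.
move=> lf fk.
pose fM := GRing.isLinear.Build R E F *:%R f lf.
pose fL : {linear E -> F} := HB.pack f fM.
rewrite -[f]/(fL : E -> F).
apply/linear_bounded_continuous/bounded_funP => r.
exists (`|k| * r) => x xr; rewrite (le_trans (fk x))//.
by rewrite (le_trans (ler_wpM2r _ (ler_norm k)))// ler_wpM2l.
Qed.

End Differentials.

Section BoundedBilinear.
Context {R : realType}.

(** A bound stands for joint continuity because it is the property that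
    visibly passes to the operations [bb_compl] induced on operators. *)
Record bounded_bilinear (E F G : normedModType R) (B : E -> F -> G) : Prop := {
  bb_linl : forall v, linear (B^~ v);
  bb_linr : forall u, linear (B u);
  bb_bound : exists2 k : R, 0 <= k & forall u v, `|B u v| <= k * `|u| * `|v| }.

Context {E F G : normedModType R} {B : E -> F -> G} (bB : bounded_bilinear B).

Lemma bb_continuous : continuous (fun p : E * F => B p.1 p.2).
Proof.
case: bB => ll lr [k k0 Bk] p; apply/cvgrPdist_lt => e e0.
have BB u v u' v' : B u v - B u' v' = B (u - u') v + B u' (v - v').
  have -> : u - u' = (-1) *: u' + u by rewrite scaleN1r addrC.
  have -> : v - v' = (-1) *: v' + v by rewrite scaleN1r addrC.
  rewrite (ll v (-1) u' u) (lr u' (-1) v' v) !scaleN1r.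
  by rewrite [RHS]addrC addrA addrK addrC.
pose C := (fun q : E * F => k * `|p.1 - q.1| * `|p.2| + k * `|q.1| * `|p.2 - q.2|).
have C0 : C @ p --> 0.
  have <- : C p = 0.
    by rewrite /C !subrr !normr0 !mulr0 mul0r addr0.
  apply: cvgD.
    apply: cvgM; last exact: cvg_cst.
    apply: cvgM; first exact: cvg_cst.
    by apply: cvg_norm; apply: cvgB; [exact: cvg_cst|exact: cvg_fst].
  apply: cvgM.
    by apply: cvgM; [exact: cvg_cst|apply: cvg_norm; exact: cvg_fst].
  by apply: cvg_norm; apply: cvgB; [exact: cvg_cst|exact: cvg_snd].
move/cvgrPdist_lt : C0 => /(_ e e0); apply: filterS => q.
rewrite sub0r normrN => /(le_lt_trans (ler_norm _)); apply: le_lt_trans.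
by rewrite BB (le_trans (ler_normD _ _))// lerD.
Qed.

Lemma is_diff_bb (D : normedModType R) (f : D -> E) (g : D -> F) (df : D -> E)
    (dg : D -> F) x :
  is_diff x f df -> is_diff x g dg ->
  is_diff x (fun y => B (f y) (g y)) (fun h => B (f x) (dg h) + B (df h) (g x)).
Proof.
move=> Df Dg.
have bf : bilinear_for (GRing.Scale.Law.clone _ _ *:%R _)
    (GRing.Scale.Law.clone _ _ *:%R _) B.
  by split=> [u'|u] a y z /=; [exact: bb_linl|exact: bb_linr].
pose BM := bilinear_isBilinear.Build R E F G _ _ B bf.
pose BL : {bilinear E -> F -> G} := HB.pack B BM.
have Bc : continuous (fun p : E * F => BL p.1 p.2) := bb_continuous.
have Dpair := is_diff_pair Df Dg.
have DB : is_diff (f x, g x) (fun p => BL p.1 p.2)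
    (fun q => BL (f x) q.2 + BL q.1 (g x)).
  apply: DiffDef; first exact: differentiable_bilin.
  by rewrite diff_bilin.
exact: (is_diff_comp Dpair DB).
Qed.

End BoundedBilinear.

Section BilinearComposition.
Context {R : realType} (D : normedModType R).

Lemma bounded_bilinear_flip (E F G : normedModType R) (B : E -> F -> G) :
  bounded_bilinear B -> bounded_bilinear (fun v u => B u v).
Proof.
case=> ll lr [k k0 Bk]; split=> //; exists k => // u v.
by rewrite mulrAC; exact: Bk.
Qed.

Context {E F G : normedModType R} {B : E -> F -> G} (bB : bounded_bilinear B).

Fact bb_compl_linear (l : clin D E) v : linear (fun h => B (l h) v).
Proof. by move=> a x y; rewrite linearP (bb_linl bB). Qed.

Fact bb_compl_bound : exists2 k : R, 0 <= k &
  forall (l : clin D E) v h, `|B (l h) v| <= k * `|l| * `|v| * `|h|.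
Proof.
have [k k0 Bk] := bb_bound bB; exists k => // l v h.
rewrite (le_trans (Bk _ _))// [leRHS]mulrAC ler_wpM2r// -mulrA ler_wpM2l//.
exact: clin_bound.
Qed.

Fact bb_compl_continuous (l : clin D E) v : continuous (fun h => B (l h) v).
Proof.
have [k k0 H] := bb_compl_bound.
exact: bounded_linear_clin_continuous (bb_compl_linear l v) (H l v).
Qed.

(** The derivative of [x |-> B (f x) (g x)] is the sum of two terms of this
    form, one of them for the flipped [B].  As [bb_compl] is again bounded and
    bilinear, the product rule can be iterated. *)
Definition bb_compl (l : clin D E) v : clin D G :=
  CLin (bb_compl_linear l v) (@bb_compl_continuous l v).

Lemma bounded_bilinear_compl : bounded_bilinear bb_compl.
Proof.
split.
- by move=> v a l m; apply: clinP => h /=; rewrite (bb_linl bB).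
- by move=> l a v w; apply: clinP => h /=; rewrite (bb_linr bB).
have [k k0 H] := bb_compl_bound.
exists k => // l v; apply: opnorm_le => h h1 /=.
by rewrite (le_trans (H _ _ _))// ler_piMr// !mulr_ge0.
Qed.

End BilinearComposition.

(** * Calculus of maps of class C^n *)

Section CnCalculus.
Context {R : realType}.
Implicit Types E F G : normedModType R.

Lemma Cn_subset n E F (U V : set E) (f : E -> F) :
  V `<=` U -> Cn n U f -> Cn n V f.
Proof.
move=> VU; elim: n F f => [|n IH] F f /=; first by move=> H x /VU; exact: H.
by move=> [f' [df Cf']]; exists f'; split; [move=> x /VU; exact: df|exact: IH].
Qed.

Lemma Cn_continuous n E F (U : set E) (f : E -> F) x :
  Cn n U f -> U x -> {for x, continuous f}.
Proof.
case: n => [|n] /=; first by move=> H; exact: H.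
move=> [f' [df _]] Ux; apply: differentiable_continuous.
by have [] := df x Ux.
Qed.

Lemma Cn_pred n E F (U : set E) (f : E -> F) : Cn n.+1 U f -> Cn n U f.
Proof.
elim: n F f => [|n IH] F f.
  by move=> H x; exact: Cn_continuous H.
by move=> [f' [df Cf']]; exists f'; split=> //; exact: IH.
Qed.

Lemma Cn_cst n E F (U : set E) (a : F) : Cn n U (cst a : E -> F).
Proof.
elim: n F a => [|n IH] F a /=; first by move=> x _; exact: cvg_cst.
by exists (cst 0); split; [move=> x _; exact: is_diff_cst|exact: IH].
Qed.

Lemma CnD n E F (U : set E) (f g : E -> F) :
  Cn n U f -> Cn n U g -> Cn n U (fun x => f x + g x).
Proof.
elim: n F f g => [|n IH] F f g /=.
  by move=> Cf Cg x Ux; apply: cvgD; [exact: Cf|exact: Cg].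
move=> [f' [df Cf]] [g' [dg Cg]]; exists (fun x => f' x + g' x); split.
  by move=> x Ux; apply: is_diffD; [exact: df|exact: dg].
exact: IH.
Qed.

(** The induction has to range over all bounded bilinear maps: the derivative
    of a product is a sum of products for the maps [bb_compl], which take
    values in a space of operators. *)
Lemma Cn_bilinear n E F1 F2 G (B : F1 -> F2 -> G) (U : set E)
    (f : E -> F1) (g : E -> F2) : bounded_bilinear B ->
  Cn n U f -> Cn n U g -> Cn n U (fun x => B (f x) (g x)).
Proof.
elim: n F1 F2 G B f g => [|n IH] F1 F2 G B f g bB Cf Cg.
  move=> x Ux.
  apply: (@continuous_comp _ _ _ (fun y => (f y, g y)) (fun p => B p.1 p.2)).
    by apply: cvg_pair; [exact: Cf|exact: Cg].
  exact: bb_continuous.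
have Cf0 := Cn_pred Cf; have Cg0 := Cn_pred Cg.
move: Cf Cg => [f' [df Cf]] [g' [dg Cg]].
have bB' := bounded_bilinear_flip bB.
exists (fun x => bb_compl bB' (g' x) (f x) + bb_compl bB (f' x) (g x)); split.
  by move=> x Ux; exact: is_diff_eq (is_diff_bb bB (df x Ux) (dg x Ux)) _.
apply: CnD; apply: IH => //; exact: bounded_bilinear_compl.
Qed.

Lemma bounded_bilinear_scale F :
  bounded_bilinear (fun (a : R^o) (v : F) => a *: v).
Proof.
split.
- by move=> v a b c; rewrite scalerDl scalerA.
- by move=> a b v w; rewrite scalerDr !scalerA mulrC.
by exists 1 => // a v; rewrite normrZ mul1r.
Qed.

Lemma CnM n E F (U : set E) (f : E -> R^o) (g : E -> F) :
  Cn n U f -> Cn n U g -> Cn n U (fun x => f x *: g x).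
Proof. exact: Cn_bilinear (bounded_bilinear_scale F). Qed.

Lemma CnZ n E F (U : set E) (a : R) (f : E -> F) :
  Cn n U f -> Cn n U (fun x => a *: f x).
Proof. exact: CnM (@Cn_cst n E R^o U a). Qed.

(** Being C^n is local.  The derivatives of the local models are pointwise
    unique, so that choosing a model at each point gives a global derivative
    which, near each point, is the derivative of a single model. *)
Lemma Cn_local n E F (U : set E) (f : E -> F) : open U ->
  (forall x, U x -> exists2 g, Cn n U g & {near x, f =1 g}) -> Cn n U f.
Proof.
move=> oU; elim: n F f => [|n IH] F f H.
  move=> x Ux; have [g Cg fg] := H x Ux.
  rewrite /prop_for /continuous_at (nbhs_singleton fg).
  by apply: cvg_trans (Cg x Ux); apply: near_eq_cvg; apply: filterS fg.
pose good x (gg' : (E -> F) * (E -> clin E F)) := U x ->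
  [/\ {near x, f =1 gg'.1}, forall y, U y -> is_diff y gg'.1 (gg'.2 y)
    & Cn n U gg'.2].
have /choice[G HG] : forall x, exists gg', good x gg'.
  move=> x; have [Ux|nUx] := pselect (U x); last first.
    by exists (cst 0, cst 0) => /nUx.
  by have [g [g' [dg Cg]] fg] := H x Ux; exists (g, g') => _; split.
have df x : U x -> is_diff x f ((G x).2 x).
  move=> Ux; have [fg dg _] := HG x Ux; apply: near_eq_is_diff (dg x Ux).
  by apply: filterS fg.
exists (fun x => (G x).2 x); split=> //; apply: IH => x Ux.
have [fg dg Cg] := HG x Ux; exists (G x).2 => //.
have Unear : \forall y \near x, U y by exact: open_nbhs_nbhs.
move/near_join : fg => fg.
near=> y; have Uy : U y by near: y.
apply: (is_diff_clin_unique (df y Uy)).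
apply: near_eq_is_diff (dg y Uy).
by near: y; apply: filterS fg => y; apply: filterS.
Unshelve. all: by end_near. Qed.

End CnCalculus.

(** * The smooth positive part *)

Section Flat.
Context {R : realType} (d : R) (d0 : 0 < d).

(** The functions [t^(-k) exp(-d/t)], extended by 0.  The derivative of each is a
    combination of two others, so the family is made of smooth functions. *)
Definition flat (k : nat) (t : R) : R :=
  if 0 < t then t^-1 ^+ k * expR (- (d * t^-1)) else 0.

Lemma flat_gt0 k t : 0 < t -> flat k t = t^-1 ^+ k * expR (- (d * t^-1)).
Proof. by rewrite /flat => ->. Qed.

Lemma flat_le0 k t : t <= 0 -> flat k t = 0.
Proof. by rewrite /flat leNgt => /negbTE ->. Qed.

Lemma flatS k t : flat k t = t * flat k.+1 t.
Proof.
have [t0|t0] := leP t 0; first by rewrite !flat_le0// mulr0.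
by rewrite !flat_gt0// exprS !mulrA mulfV ?mul1r// gt_eqF.
Qed.

(** With [s = t^-1], [s ^+ k * expR (- (d * s))] is at most [k`! / d ^+ k], since
    [expR (d * s)] dominates its term of degree [k]. *)
Lemma flat_bounded k : exists2 C : R, 0 <= C & forall t, `|flat k t| <= C.
Proof.
exists (k`!%:R / d ^+ k) => [|t].
  by rewrite divr_ge0// exprn_ge0// ltW.
have [t0|t0] := leP t 0; first by rewrite flat_le0// normr0 divr_ge0// exprn_ge0// ltW.
have it0 : 0 < t^-1 by rewrite invr_gt0.
rewrite flat_gt0// ger0_norm ?mulr_ge0 ?expR_ge0 ?exprn_ge0 ?(ltW it0)//.
rewrite expRN ler_pdivrMr ?expR_gt0// mulrAC ler_pdivlMr ?exprn_gt0//.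
rewrite -exprMn_comm; last exact: mulrC.
rewrite [t^-1 * d]mulrC [leRHS]mulrC -ler_pdivrMr ?ltr0n ?fact_gt0//.
case: k => [|k].
  rewrite expr0 invr1 mulr1; apply: le_trans (expR_ge1Dx _).
  by rewrite lerDl mulr_ge0 ?ltW.
apply: le_trans (expR_ge1Dxn k _); last by rewrite mulr_ge0 ?ltW.
by rewrite lerDr.
Qed.

Lemma is_diff_derive1 (f : R -> R) (a t : R) : is_derive t 1 f a ->
  is_diff t (f : R^o -> R^o) (fun h => a *: h).
Proof.
move=> [Hd He]; apply: DiffDef; first exact/derivable1_diffP.
rewrite deriv1E// derive1E He; apply/funext => h.
by rewrite /GRing.scale/= mulrC.
Qed.

(** At 0, [flatS] applied twice gives [flat k h = h ^+ 2 * flat k.+2 h], which is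
    [o(h)] because [flat k.+2] is bounded. *)
Lemma is_diff_flat k t : is_diff t (flat k : R^o -> R^o)
  (fun h => (d * flat k.+2 t - k%:R * flat k.+1 t) *: h).
Proof.
have [t0|t0|->] := ltgtP t 0.
- rewrite !flat_le0 ?ltW// !mulr0 subr0.
  apply: is_diff_derive1; apply: near_eq_is_derive (is_derive_cst 0 t 1).
  near=> s; rewrite flat_le0//.
  by near: s; apply: filterS (lt_nbhsl t0) => y /ltW.
- apply: is_diff_derive1.
  have nt0 : t != 0 by rewrite gt_eqF.
  have dV : is_derive t 1 (fun s : R => s^-1) (- (t ^- 2)).
    have := @is_deriveV R id t 1 1 nt0 (is_derive_id _ _).
    by rewrite /GRing.scale/= mulr1.
  have dE : is_derive t 1 (fun s : R => expR (- (d * s^-1)))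
      (expR (- (d * t^-1)) * (d * t ^- 2)).
    have dI : is_derive t 1 (fun s : R => - (d * s^-1)) (d * t ^- 2).
      have := is_deriveN (is_deriveZ d dV).
      by rewrite /GRing.scale/= mulrN opprK.
    exact: (@is_derive1_comp _ expR (fun s : R => - (d * s^-1))).
  have := is_deriveM (is_deriveX k dV) dE.
  rewrite exprfctE /GRing.scale/= => dP.
  apply: (@near_eq_is_derive _ _ _ (fun s : R => s^-1 ^+ k * expR (- (d * s^-1)))).
    near=> s; rewrite flat_gt0//.
    by near: s; exact: lt_nbhsr.
  apply: is_derive_eq dP _; rewrite !flat_gt0//.
  have -> : t ^- 2 = t^-1 * t^-1 by rewrite expr2 invfM.
  by case: k => [|k]; rewrite /= !exprS ?expr0; ring.
- rewrite !flat_le0// !mulr0 subr0.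
  have H : is_diff (0 : R) (flat k : R^o -> R^o) (0 : clin R^o R^o).
    apply/is_diff_clinP => e e0.
    have [C C0 HC] := flat_bounded k.+2.
    have C10 : 0 < C + 1 by rewrite ltr_wpDl.
    near=> h; rewrite addr0 [flat k 0]flat_le0// !subr0 flatS normrM mulrC ler_wpM2r//.
    rewrite flatS normrM.
    have : `|h| <= e / (C + 1).
      by near: h; apply: (@nbhs0_le _ R^o); rewrite divr_gt0.
    rewrite ler_pdivlMr//; apply: le_trans.
    by rewrite ler_wpM2l// (le_trans (HC _))// lerDl.
  by apply: is_diff_eq H _; apply/funext => h; rewrite scale0r.
Unshelve. all: by end_near. Qed.

End Flat.

Section SoftPositivePart.
Context {R : realType} (d : R) (d0 : 0 < d).

Lemma Cn_flat n (E : normedModType R) (U : set E) (f : E -> R^o) k :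
  Cn n U f -> Cn n U (fun x => flat d k (f x) : R^o).
Proof.
elim: n k => [|n IH] k Cf.
  move=> x Ux; apply: (@continuous_comp _ _ _ f (flat d k : R^o -> R^o)).
    exact: Cf.
  by apply: differentiable_continuous; have [] := is_diff_flat d0 k (f x).
have Cf0 := Cn_pred Cf; move: Cf => [f' [df Cf']].
exists (fun x => (d * flat d k.+2 (f x) - k%:R * flat d k.+1 (f x)) *: f' x).
split=> [x Ux|].
  exact: is_diff_eq (is_diff_comp (df x Ux) (is_diff_flat d0 k (f x))) _.
apply: CnM Cf'.
pose g x : R^o := d *: (flat d k.+2 (f x) : R^o) + (- k%:R) *: (flat d k.+1 (f x) : R^o).
have -> : (fun x => d * flat d k.+2 (f x) - k%:R * flat d k.+1 (f x)) = g.
  by apply/funext => x; rewrite /g /GRing.scale/= mulNr.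
by apply: CnD; apply: CnZ; exact: IH.
Qed.

(** The gluing rests on exact vanishing on the left half-line.  The price is
    paid on the right, where [t * exp(-d/t)] approaches [t - d] instead of [t]. *)
Definition soft_pos (t : R) : R := t * flat d 0 t.

Lemma Cn_soft_pos n (E : normedModType R) (U : set E) (f : E -> R^o) :
  Cn n U f -> Cn n U (fun x => soft_pos (f x) : R^o).
Proof. by move=> Cf; apply: CnM => //; exact: Cn_flat. Qed.

Lemma flat0_gt0 t : 0 < t -> flat d 0 t = expR (- (d * t^-1)).
Proof. by move=> t0; rewrite flat_gt0// expr0 mul1r. Qed.

Lemma soft_pos_le0 t : t <= 0 -> soft_pos t = 0.
Proof. by move=> t0; rewrite /soft_pos flat_le0// mulr0. Qed.

Lemma soft_pos_ge t : t - d <= soft_pos t.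
Proof.
have [t0|t0] := leP t 0.
  by rewrite soft_pos_le0// subr_le0 (le_trans t0)// ltW.
rewrite /soft_pos flat0_gt0// mulrC -ler_pdivrMr//.
apply: le_trans (expR_ge1Dx _).
by rewrite mulrBl divff// gt_eqF.
Qed.

Lemma soft_pos_le_max t : soft_pos t <= Num.max 0 t.
Proof.
have [t0|t0] := leP t 0; first by rewrite soft_pos_le0.
rewrite /soft_pos flat0_gt0// ler_piMr ?ltW// expR_lt1 oppr_lt0.
by rewrite mulr_gt0// invr_gt0.
Qed.

(** The derivative of [soft_pos d]; it serves as the slope of supporting lines
    in [soft_pos_support]. *)
Definition slope (t : R) : R := flat d 0 t + d * flat d 1 t.

Lemma slope_gt0 t : 0 < t -> slope t = (1 + d * t^-1) * expR (- (d * t^-1)).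
Proof.
by move=> t0; rewrite /slope !flat_gt0// expr0 expr1 mul1r mulrDl mul1r mulrA.
Qed.

Lemma slope_ge0 t : 0 <= slope t.
Proof.
have [t0|t0] := leP t 0; first by rewrite /slope !flat_le0// mulr0 addr0.
have ti0 : 0 < t^-1 by rewrite invr_gt0.
by rewrite slope_gt0// mulr_ge0 ?expR_ge0// addr_ge0// ltW// mulr_gt0.
Qed.

Lemma slope_lt1 t : slope t < 1.
Proof.
have [t0|t0] := leP t 0; first by rewrite /slope !flat_le0// mulr0 addr0.
have ti0 : 0 < t^-1 by rewrite invr_gt0.
rewrite slope_gt0// expRN ltr_pdivrMr ?expR_gt0// mul1r expR_gt1Dx//.
by rewrite gt_eqF// mulr_gt0.
Qed.

(** For [0 < t] and [0 < s], after division by [s * expR (- d / t)], this is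
    [1 + y <= expR y] at [y = d / t - d / s]. *)
Lemma soft_pos_support t s : soft_pos t + slope t * (s - t) <= soft_pos s.
Proof.
have sp_ge0 r : 0 <= soft_pos r.
  have [r0|r0] := leP r 0; first by rewrite soft_pos_le0.
  by rewrite /soft_pos flat0_gt0// mulr_ge0 ?expR_ge0// ltW.
have [t0|t0] := leP t 0.
  by rewrite soft_pos_le0// /slope !flat_le0// mulr0 addr0 mul0r addr0.
have -> : soft_pos t + slope t * (s - t) =
    (s + d * (s * t^-1) - d) * expR (- (d * t^-1)).
  rewrite /soft_pos slope_gt0// flat0_gt0//.
  have : t * t^-1 = 1 by rewrite mulfV// gt_eqF.
  move: (t^-1) (expR _) => u e tu.
  have -> : t * e + (1 + d * u) * e * (s - t) =
      (s + d * (s * u) - d * (t * u)) * e by ring.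
  by rewrite tu mulr1.
have [s0|s0] := leP s 0.
  apply: le_trans (sp_ge0 s); rewrite mulr_le0_ge0 ?expR_ge0//.
  have : d * (s * t^-1) <= 0.
    by rewrite mulr_ge0_le0 ?(ltW d0)// mulr_le0_ge0// invr_ge0 ltW.
  by move=> r0; rewrite subr_le0 (le_trans (lerD s0 r0))// addr0 ltW.
rewrite /soft_pos flat0_gt0// [leRHS](_ : _ =
    s * expR (d * t^-1 - d * s^-1) * expR (- (d * t^-1))).
  rewrite ler_wpM2r ?expR_ge0//.
  apply: (@le_trans _ _ (s * (1 + (d * t^-1 - d * s^-1)))).
    have : s * s^-1 = 1 by rewrite mulfV// gt_eqF.
    move: (t^-1) (s^-1) => u v sv.
    have -> : s * (1 + (d * u - d * v)) = s + d * (s * u) - d * (s * v) by ring.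
    by rewrite sv mulr1.
  by rewrite ler_wpM2l ?(ltW s0)// expR_ge1Dx.
by rewrite -mulrA -expRD addrAC subrr add0r.
Qed.

Lemma slope_mono t s : t <= s -> slope t <= slope s.
Proof.
rewrite le_eqVlt => /predU1P[->//|ts].
have st0 : 0 < s - t by rewrite subr_gt0.
have H1 := soft_pos_support t s; have H2 := soft_pos_support s t.
rewrite -(ler_pM2r st0); lra.
Qed.

End SoftPositivePart.

(** * Gluing along an exhaustion *)

Lemma nested_subset T (B : nat -> set T) (m n : nat) :
  (forall k, B k `<=` B k.+1) -> (m <= n)%N -> B m `<=` B n.
Proof.
move=> BS; elim: n => [|n IH]; first by rewrite leqn0 => /eqP->.
rewrite leq_eqVlt ltnS => /predU1P[->//|/IH] mn.
exact: subset_trans (BS n).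
Qed.

Section Gluing.
Context {R : realType}.

Definition soft_max T (d : R) (u v : T -> R) (x : T) : R :=
  u x + soft_pos d (v x - u x).

Context {T : Type} (P : (T -> R) -> Prop) (B : nat -> set T) (f : T -> R).
Hypothesis B_nested : forall n, B n `<=` B n.+1.
Hypothesis P_soft_max : forall (d : R) u v, 0 < d -> P u -> P v -> P (soft_max d u v).
Hypothesis P_local : forall g,
  (forall n, exists2 h, P h & {in B n, g =1 h}) -> P g.
Hypothesis P_approx : forall n (a d : R), 0 < d -> exists h,
  [/\ P h, forall x, (\bigcup_m B m) x -> h x <= f x - a
    & forall x, B n x -> f x - a - d <= h x].

(** Each step leaves [g_n] unchanged on [B n] because the new approximant
    stays below [f - loss n], hence below [g_n], there. *)
Lemma glue_soft_max (e : R) : 0 < e -> exists g,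
  P g /\ forall x, (\bigcup_m B m) x -> f x - e <= g x <= f x.
Proof.
move=> e0.
pose eta n : R := e / 2 ^+ n.
have eta_gt0 n : 0 < eta n by rewrite divr_gt0// exprn_gt0.
have etaS n : eta n = eta n.+1 + eta n.+1.
  by rewrite /eta exprSr invfM mulrA -splitr.
pose loss n : R := e - eta n.+1.
have loss_ge0 n : 0 <= loss n.
  elim: n => [|n]; rewrite /loss.
    by have := etaS 0%N; rewrite {1}/eta expr0 divr1 => ->; rewrite addrK ltW.
  by have := etaS n.+1; have := eta_gt0 n.+2; lra.
pose inv n g := [/\ P g, forall x, (\bigcup_m B m) x -> g x <= f x
  & forall x, B n x -> f x - loss n <= g x].
have /choice[step Hstep] : forall ng : nat * (T -> R), exists g',
    inv ng.1 ng.2 -> inv ng.1.+1 g' /\ {in B ng.1, g' =1 ng.2}.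
  move=> [n g] /=; have [[Pg gf fg]|nI] := pselect (inv n g); last by exists g.
  (* One [d] is lost in the approximation, another one in [soft_max]. *)
  pose d := eta n.+3; have d0 : 0 < d := eta_gt0 _.
  have lossd : loss n.+1 = loss n + d + d.
    by rewrite /loss (etaS n.+1) [eta n.+2]etaS -/d; ring.
  have [h [Ph hf fh]] := P_approx n.+1 (loss n) d0.
  exists (soft_max d g h) => _; split; [split|].
  - exact: P_soft_max.
  - move=> x Ux; have gfx := gf x Ux.
    have hfx : h x <= f x.
      by apply: le_trans (hf x Ux) _; rewrite gerBl.
    rewrite /soft_max -lerBrDl (le_trans (soft_pos_le_max _ _))//.
    by rewrite ge_max subr_ge0 gfx lerB.
  - move=> x Bx; have fhx := fh x Bx.
    have := soft_pos_ge d0 (h x - g x); rewrite /soft_max lossd => H.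
    lra.
  - move=> x /set_mem Bx; rewrite /soft_max soft_pos_le0 ?addr0// subr_le0.
    by apply: le_trans (fg x Bx); apply: hf; exists n.
have [g0 inv0] : exists g0, inv 0%N g0.
  have [h [Ph hf fh]] := P_approx 0 0 (eta_gt0 1%N).
  exists h; split=> // [x Ux|x Bx]; first by rewrite -[leRHS]subr0 hf.
  apply: le_trans (fh x Bx); rewrite subr0 lerD2l lerN2 /loss.
  by rewrite lerBrDr -etaS /eta expr0 divr1.
pose G := fix G n := if n is m.+1 then step (m, G m) else g0.
have invG n : inv n (G n) by elim: n => // n /(Hstep (n, _))[].
have GS n : {in B n, G n.+1 =1 G n} := (Hstep (n, G n) (invG n)).2.
have Gstable m n x : (m <= n)%N -> B m x -> G n x = G m x.
  move=> + Bx; elim: n => [|n IH]; first by rewrite leqn0 => /eqP->.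
  rewrite leq_eqVlt ltnS => /predU1P[->//|mn]; rewrite GS ?IH//; apply/mem_set.
  exact: (nested_subset B_nested mn).
have /choice[i Hi] : forall x, exists n, (\bigcup_m B m) x -> B n x.
  move=> x; have [[n _ Bx]|nU] := pselect ((\bigcup_m B m) x).
    by exists n.
  by exists 0%N => /nU.
have gG n x : B n x -> G (i x) x = G n x.
  move=> Bx; have Bi : B (i x) x by apply: Hi; exists n.
  by have [ni|/ltnW ni] := leqP n (i x); [|apply/esym]; exact: Gstable.
exists (fun x => G (i x) x); split=> [|x [n _ Bx]].
  apply: P_local => n; exists (G n); first by have [] := invG n.
  by move=> x /set_mem; exact: gG.
rewrite (gG n)//; have [_ Gf fG] := invG n.
rewrite Gf ?andbT; last by exists n.
by apply: le_trans (fG x Bx); rewrite lerD2l lerN2 gerBl ltW.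
Qed.

End Gluing.

(** * Convex functions on an interval *)

Section ConvexOnInterval.
Context {R : realType}.

Lemma convex_functionP (D : set R) (f : R -> R) :
  @convex_function R R^o D f <->
  forall x y p q : R, D x -> D y -> 0 <= p -> 0 <= q -> p + q = 1 ->
    f (p * x + q * y) <= p * f x + q * f y.
Proof.
split=> [cf x y p q Dx Dy p0 q0 pq|cf t x y /set_mem Dx /set_mem Dy].
  have p1 : p <= 1 by rewrite -pq lerDl.
  have -> : q = 1 - p by rewrite -pq addrC addKr.
  exact: (cf (Itv01 p0 p1) x y (mem_set Dx) (mem_set Dy)).
have t1 : t%:num <= 1 by [].
by apply: (cf x y t%:num (1 - t%:num)) => //; rewrite ?subr_ge0// addrC subrK.
Qed.

Lemma itv_conv (a b x y p q : R) : `]a, b[ x -> `]a, b[ y ->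
  0 <= p -> 0 <= q -> p + q = 1 -> `]a, b[ (p * x + q * y).
Proof.
rewrite /= !in_itv/= => /andP[ax xb] /andP[ay yb] p0 q0 pq.
have -> : q = 1 - p by rewrite -pq addrC addKr.
have [->|p'0] := eqVneq p 0; first by rewrite mul0r subr0 mul1r add0r ay.
have {p'0}p0 : 0 < p by rewrite lt_neqAle eq_sym p'0.
have p1 : 0 <= 1 - p by rewrite -pq addrC addKr.
apply/andP; split; nra.
Qed.

(** Let [m] be the slope at [z].  By the supporting line there, the function
    is bounded below by [(K - m) u + m v] plus a constant, with equality at [z],
    and this lower bound is convex since [0 <= m <= K].  The constant [K] is 1 for
    convexity and less than 1 for strong convexity. *)
Lemma convex_soft_max (a b d K : R) (u v : R -> R) : 0 < d ->
  @convex_function R R^o `]a, b[ u -> @convex_function R R^o `]a, b[ v ->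
  (forall t, `]a, b[ t -> slope d (v t - u t) <= K) ->
  @convex_function R R^o `]a, b[ (fun t => K * u t + soft_pos d (v t - u t)).
Proof.
move=> d0 /convex_functionP cu /convex_functionP cv mK.
apply/convex_functionP => x y p q Dx Dy p0 q0 pq.
have Dz := itv_conv Dx Dy p0 q0 pq.
set z := p * x + q * y in Dz *.
have cuz : u z <= p * u x + q * u y by exact: cu.
have cvz : v z <= p * v x + q * v y by exact: cv.
have m0 := slope_ge0 d0 (v z - u z); have {}mK := mK z Dz.
have Hx := soft_pos_support d0 (v z - u z) (v x - u x).
have Hy := soft_pos_support d0 (v z - u z) (v y - u y).
move: (slope d _) (soft_pos d _) (soft_pos d _) (soft_pos d _) m0 mK Hx Hy.
move=> m sz sx sy m0 mK Hx Hy.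
have Km0 : 0 <= K - m by rewrite subr_ge0.
have {}cuz := ler_wpM2l Km0 cuz; have {}cvz := ler_wpM2l m0 cvz.
have {}Hx := ler_wpM2l p0 Hx; have {}Hy := ler_wpM2l q0 Hy.
have qE : q = 1 - p by rewrite -pq addrC addKr.
rewrite qE in cuz cvz Hx Hy *.
lra.
Qed.

(** The derivative takes the default value 0 where the difference quotient
    has no limit, so a nonzero value certifies differentiability. *)
Lemma derivable_of_derive1_gt0 (f : R -> R) t : 0 < f^`() t -> derivable f t 1.
Proof.
move=> f0; apply: contrapT => /dvgP; move: f0; rewrite derive1E /derive => + H.
by rewrite H ltxx.
Qed.

Lemma convex_derive2 (a b : R) (f : R -> R) :
  (forall t, `]a, b[ t -> derivable f t 1) ->
  (forall t, `]a, b[ t -> 0 < f^`(2) t) ->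
  @convex_function R R^o `]a, b[ f.
Proof.
move=> df d2f.
have D1E : f^`() = 'D_1 f by apply/funext => t; rewrite derive1E.
have fc t : `]a, b[ t -> {for t, continuous f}.
  by move=> /df /derivable1_diffP/differentiable_continuous.
have sub x y z : `]a, b[ x -> `]a, b[ y -> x < z < y -> `]a, b[ z.
  rewrite /= !in_itv/= => /andP[ax _] /andP[_ yb] /andP[xz zy].
  by rewrite (lt_trans ax xz) (lt_trans zy yb).
have main x y t : `]a, b[ x -> `]a, b[ y -> x <= y ->
    f (conv t (x : R^o) (y : R^o)) <= conv t (f x : R^o) (f y : R^o).
  move=> Dx Dy xy; apply: second_derivative_convex => //.
  - move=> z /(sub _ _ _ Dx Dy) /d2f.
    by rewrite derive1nS derive1n1 derive1E D1E => /ltW.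
  - by apply: cvg_at_left_filter; exact: fc.
  - by apply: cvg_at_right_filter; exact: fc.
  - by move=> z; rewrite in_itv/= => /(sub _ _ _ Dx Dy); exact: df.
  - move=> z; rewrite in_itv/= => /(sub _ _ _ Dx Dy) /d2f.
    by rewrite derive1nS derive1n1 -D1E; exact: derivable_of_derive1_gt0.
move=> t x y /set_mem Dx /set_mem Dy.
have [xy|/ltW yx] := leP x y; first exact: main.
by rewrite convC [leRHS]convC; exact: main.
Qed.

Lemma derive1nZ2 (a b K : R) (f : R -> R) :
  (forall t, `]a, b[ t -> derivable f t 1) ->
  (forall t, `]a, b[ t -> 0 < f^`(2) t) ->
  forall t, `]a, b[ t -> ((fun s => K * f s)^`(2) t = K * f^`(2)%classic t).
Proof.
move=> df d2f t Dt; have := d2f t Dt.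
rewrite !derive1nS !derive1n0 => /derivable_of_derive1_gt0 df't.
rewrite -derive1Ml//; rewrite !derive1E; apply: near_eq_derive.
have : \forall s \near t, `]a, b[%classic s.
  by apply: open_nbhs_nbhs; split=> //; exact: itv_open.
by apply: filterS => s Ds; rewrite derive1Ml//; exact: df.
Qed.

End ConvexOnInterval.

(** * Spaces with C^k functions *)

Section SmoothSpace.
Context {R : realType}.

(** The common part of calculus on normed spaces and on Riemannian manifolds.
    The last property makes functions of class C^2 restrict to differentiable
    functions on geodesics; the second derivatives are then controlled by
    [derivable_of_derive1_gt0]. *)
Record smooth_calculus (X : Defs.space R) : Prop := {
  sc_subset : forall k (U V : set X) f,
    V `<=` U -> sp_Ck k U f -> sp_Ck k V f;
  sc_continuous : forall k (U : set X) f x,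
    open U -> sp_Ck k U f -> U x -> {for x, continuous f};
  sc_add : forall k (U : set X) f g,
    sp_Ck k U f -> sp_Ck k U g -> sp_Ck k U (fun x => f x + g x);
  sc_scale : forall k (U : set X) (a : R) f,
    sp_Ck k U f -> sp_Ck k U (fun x => a * f x);
  sc_soft_pos : forall k (U : set X) (d : R) f, 0 < d ->
    sp_Ck k U f -> sp_Ck k U (fun x => soft_pos d (f x));
  sc_local : forall k (U : set X) f, open U ->
    (forall x, U x -> exists2 g, sp_Ck k U g & {near x, f =1 g}) ->
    sp_Ck k U f;
  sc_derivable : forall (U : set X) f a b c t, open U ->
    sp_Ck (Cfin 2) U f -> geodesic_in U a b c -> `]a, b[ t ->
    derivable (f \o c) t 1 }.

Context {X : Defs.space R} (sX : smooth_calculus X).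
Implicit Types (U V : set X) (f g phi : X -> R).

Lemma sc_soft_max k U (d : R) f g : 0 < d ->
  sp_Ck k U f -> sp_Ck k U g -> sp_Ck k U (soft_max d f g).
Proof.
move=> d0 Cf Cg; apply: sc_add => //.
apply: (sc_soft_pos sX (f := fun x => g x - f x)) => //.
have -> : (fun x => g x - f x) = (fun x => g x + (-1) * f x).
  by apply/funext => x; rewrite mulN1r.
by apply: sc_add => //; exact: sc_scale.
Qed.

Lemma geodesic_in_subset U V a b (c : R -> X) :
  V `<=` U -> geodesic_in V a b c -> geodesic_in U a b c.
Proof. by move=> VU [gc cV]; split=> // t /cV /VU. Qed.

Lemma gconvex_fun_subset U V f : V `<=` U -> gconvex_fun U f -> gconvex_fun V f.
Proof. by move=> VU cf a b c /(geodesic_in_subset VU); exact: cf. Qed.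

Lemma gconvex_funD U f g : gconvex_fun U f -> gconvex_fun U g ->
  gconvex_fun U (fun x => f x + g x).
Proof.
move=> cf cg a b c gc; have /convex_functionP hf := cf a b c gc.
have /convex_functionP hg := cg a b c gc.
apply/convex_functionP => x y p q Dx Dy p0 q0 pq /=.
by rewrite !mulrDr addrACA lerD//; [exact: hf|exact: hg].
Qed.

Lemma gconvex_funZ U (a : R) f : 0 <= a -> gconvex_fun U f ->
  gconvex_fun U (fun x => a * f x).
Proof.
move=> a0 cf s t c gc; have /convex_functionP hf := cf s t c gc.
apply/convex_functionP => x y p q Dx Dy p0 q0 pq /=.
rewrite mulrCA [q * (a * _)]mulrCA -mulrDr ler_wpM2l//; exact: hf.
Qed.

Lemma gconvex_fun_cst U (a : R) : gconvex_fun U (fun=> a).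
Proof.
move=> s t c gc; apply/convex_functionP => x y p q Dx Dy p0 q0 pq /=.
by rewrite -mulrDl pq mul1r.
Qed.

(** For [K = 1] this is the convexity of [soft_max]. *)
Lemma gconvex_soft_max U (d K : R) f g : 0 < d ->
  gconvex_fun U f -> gconvex_fun U g ->
  (forall x, U x -> slope d (g x - f x) <= K) ->
  gconvex_fun U (fun x => K * f x + soft_pos d (g x - f x)).
Proof.
move=> d0 cf cg mK a b c gc.
apply: (convex_soft_max d0 (cf a b c gc) (cg a b c gc)) => t /gc.2; exact: mK.
Qed.

Lemma strongly_convex_C2_subset U V phi : V `<=` U ->
  strongly_convex_C2 U phi -> strongly_convex_C2 V phi.
Proof.
move=> VU [C2 cphi]; split; first exact: sc_subset C2.
by move=> a b c /(geodesic_in_subset VU); exact: cphi.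
Qed.

(** Strict positivity of the second derivative is only available on nonconstant
    geodesics; on constant ones convexity is trivial. *)
Lemma strongly_convex_C2_gconvex V phi : open V ->
  strongly_convex_C2 V phi -> gconvex_fun V phi.
Proof.
move=> oV [C2 cphi] a b c gc.
have [ncst|cst] := pselect (exists s t, [/\ `]a, b[ s, `]a, b[ t & c s <> c t]).
  apply: convex_derive2; last exact: cphi.
  by move=> t; exact: sc_derivable gc.
apply/convex_functionP => x y p q Dx Dy p0 q0 pq /=.
have ceq s t : `]a, b[ s -> `]a, b[ t -> c s = c t.
  by move=> Ds Dt; apply: contrapT => st; apply: cst; exists s, t.
have Dz := itv_conv Dx Dy p0 q0 pq.
by rewrite (ceq _ _ Dx Dz) (ceq _ _ Dy Dz) -mulrDl pq mul1r.
Qed.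

Lemma strongly_convex_C2Z V (a : R) phi : open V -> 0 < a ->
  strongly_convex_C2 V phi -> strongly_convex_C2 V (fun x => a * phi x).
Proof.
move=> oV a0 [C2 cphi]; split; first exact: sc_scale.
move=> s t c gc nc r Dr.
have H := cphi s t c gc nc.
have dphi r' : `]s, t[ r' -> derivable (phi \o c) r' 1.
  by exact: sc_derivable gc.
rewrite (_ : _ \o c = fun x => a * (phi \o c) x)// (derive1nZ2 a dphi H)//.
by rewrite mulr_gt0// H.
Qed.

(** Where [g - f < T], the slope is at most [K = slope d T < 1].  Writing
    [soft_max d f g - (1 - K) phi] as
    [(1 - K) (f - phi) + (K f + soft_pos d (g - f))] shows that it is convex
    when [phi] is a local witness of the strong convexity of [f]. *)
Lemma strongly_convex_soft_max U (d : R) f g : open U -> 0 < d ->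
  (forall x, U x -> {for x, continuous f}) ->
  (forall x, U x -> {for x, continuous g}) ->
  strongly_convex U f -> strongly_convex U g ->
  strongly_convex U (soft_max d f g).
Proof.
move=> oU d0 fc gc sf sg p Up.
have [V1 [phi [oV1 V1p V1U sphi cfphi]]] := sf p Up.
have [V2 [psi [oV2 V2p _ spsi cgpsi]]] := sg p Up.
pose T := g p - f p + 1; pose K := slope d T.
pose V := V1 `&` V2 `&` [set x | g x - f x < T]^°.
have K1 : 0 < 1 - K by rewrite subr_gt0 slope_lt1.
have oV : open V by apply: openI; [exact: openI|exact: open_interior].
have VV1 : V `<=` V1 by move=> x [[]].
have VV2 : V `<=` V2 by move=> x [[]].
have {}sphi := strongly_convex_C2_subset VV1 sphi.
have {}spsi := strongly_convex_C2_subset VV2 spsi.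
have cf : gconvex_fun V f.
  have -> : f = (fun x => (f x - phi x) + phi x).
    by apply/funext => x; rewrite subrK.
  apply: gconvex_funD; first exact: gconvex_fun_subset cfphi.
  exact: strongly_convex_C2_gconvex.
have cg : gconvex_fun V g.
  have -> : g = (fun x => (g x - psi x) + psi x).
    by apply/funext => x; rewrite subrK.
  apply: gconvex_funD; first exact: gconvex_fun_subset cgpsi.
  exact: strongly_convex_C2_gconvex.
exists V, (fun x => (1 - K) * phi x); split.
- exact: oV.
- split; first by split.
  rewrite /interior/=.
  have : {for p, continuous (fun x => g x - f x)}.
    by apply: cvgB; [exact: gc|exact: fc].
  by move=> /cvgr_lt; apply; rewrite ltrDl.
- by move=> x /VV1 /V1U.
- exact: strongly_convex_C2Z.
- have -> : (fun x => soft_max d f g x - (1 - K) * phi x) =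
      (fun x => (1 - K) * (f x - phi x) + (K * f x + soft_pos d (g x - f x))).
    by apply/funext => x; rewrite /soft_max; ring.
  apply: gconvex_funD.
    by apply: gconvex_funZ; [exact: ltW|exact: gconvex_fun_subset cfphi].
  apply: gconvex_soft_max => // x [_ /interior_subset/= xT].
  exact/slope_mono/ltW.
Qed.

Section Exhaustion.
Context {U : set X} (k : smoothness) (B : nat -> set X).
Hypotheses (oU : open U) (UB : U = \bigcup_n B n)
  (oB : forall n, open (B n)) (bB : forall n, bounded (B n))
  (dB : forall n, (0 < set_dist (B n) (frontier U))%E)
  (cB : forall n, closure (B n) `<=` B n.+1).

Let nested n : B n `<=` B n.+1.
Proof. by move=> x Bx; apply: cB; exact: subset_closure. Qed.

Let sub n : B n `<=` U.
Proof. by rewrite UB => x Bx; exists n. Qed.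

Let Bmono m n : (m <= n)%N -> B m `<=` B n.
Proof. exact: nested_subset nested. Qed.

Lemma Ck_exhaustion g :
  (forall n, exists2 h, sp_Ck k U h & {in B n, g =1 h}) -> sp_Ck k U g.
Proof.
move=> H; apply: (sc_local sX) => // x; rewrite {1}UB => -[n _ Bx].
have [h Ch gh] := H n; exists h => //.
have : \forall y \near x, B n y by exact: open_nbhs_nbhs.
by apply: filterS => y By; apply: gh; exact/mem_set.
Qed.

(** The three points of a convexity inequality lie in a common [B n], where
    [g] coincides with a single function convex on all of [U]. *)
Lemma gconvex_exhaustion g :
  (forall n, exists2 h, gconvex_fun U h & {in B n, g =1 h}) -> gconvex_fun U g.
Proof.
move=> H a b c gc; apply/convex_functionP => x y p q Dx Dy p0 q0 pq /=.
have Dz := itv_conv Dx Dy p0 q0 pq.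
have inB t : `]a, b[ t -> exists n, B n (c t).
  by move=> /gc.2; rewrite UB => -[n _]; exists n.
have [i Bx] := inB x Dx; have [j By] := inB y Dy; have [l Bz] := inB _ Dz.
pose n := maxn i (maxn j l); have [h ch gh] := H n.
rewrite !gh; first by have /convex_functionP hc := ch a b c gc; exact: hc.
- by apply/mem_set; apply: Bmono By; rewrite /n !leq_max leqnn orbT.
- by apply/mem_set; apply: Bmono Bx; rewrite /n leq_max leqnn.
- by apply/mem_set; apply: Bmono Bz; rewrite /n !leq_max leqnn !orbT.
Qed.

Lemma strongly_convex_exhaustion g :
  (forall n, exists2 h, strongly_convex U h & {in B n, g =1 h}) ->
  strongly_convex U g.
Proof.
move=> H p; rewrite {1}UB => -[n _ Bp].
have [h sh gh] := H n; have [V [phi [oV Vp VU sphi chphi]]] := sh p (sub Bp).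
have VV : V `&` B n `<=` V by move=> x [].
exists (V `&` B n), phi; split.
- exact: openI.
- by split.
- by move=> x /VV /VU.
- exact: strongly_convex_C2_subset sphi.
- move=> a b c gc.
  have /convex_functionP hc := chphi a b c (geodesic_in_subset VV gc).
  apply/convex_functionP => x y p' q Dx Dy p0 q0 pq /=.
  have Dz := itv_conv Dx Dy p0 q0 pq.
  have ghc t : `]a, b[ t -> g (c t) = h (c t).
    by move=> /gc.2[_ Bct]; apply: gh; exact/mem_set.
  by rewrite !ghc//; exact: hc.
Qed.

(** The sets [B n] are admissible for the approximation on bounded subsets, and
    continuous convex functions may be shifted by constants, which is all that
    the gluing asks for. *)
Lemma uniform_of_bounded (P : set X -> (X -> R) -> Prop) :
  (forall (d : R) f g, 0 < d -> P U f -> P U g -> P U (soft_max d f g)) ->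
  (forall g, (forall n, exists2 h, P U h & {in B n, g =1 h}) -> P U g) ->
  (forall f, continuous_convex U f -> approx_below_on_bounded P U f) ->
  forall f, continuous_convex U f -> approx_below_uniformly P U f.
Proof.
move=> Pmax Ploc Papp f [fc fconv] e e0.
rewrite /approx_below_uniformly {2}UB; apply: glue_soft_max => // n a d d0.
have cc : continuous_convex U (fun x => f x - a).
  split; last by apply: gconvex_funD => //; exact: gconvex_fun_cst.
  by move=> x Ux; apply: cvgB; [exact: fc|exact: cvg_cst].
have cBU : closure (B n) `<=` U by move=> x /cB; exact: sub.
have [h [Ph hf fh]] := Papp _ cc (B n) (bB n) cBU (dB n) d d0.
by exists h; rewrite -UB.
Qed.

Lemma Ck_convex_uniform :
  (forall f, continuous_convex U f -> approx_below_on_bounded (Ck_convex k) U f) ->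
  forall f, continuous_convex U f -> approx_below_uniformly (Ck_convex k) U f.
Proof.
apply: uniform_of_bounded => [d f g d0 [Cf cf] [Cg cg]|g H].
  split; first exact: sc_soft_max.
  rewrite (_ : soft_max d f g = fun x => 1 * f x + soft_pos d (g x - f x)).
    by apply: gconvex_soft_max => // x _; exact/ltW/slope_lt1.
  by apply/funext => x; rewrite mul1r.
by split; [apply: Ck_exhaustion|apply: gconvex_exhaustion] => n;
  have [h [Ch ch] gh] := H n; exists h.
Qed.

Lemma Ck_strongly_convex_uniform :
  (forall f, continuous_convex U f ->
    approx_below_on_bounded (Ck_strongly_convex k) U f) ->
  forall f, continuous_convex U f ->
    approx_below_uniformly (Ck_strongly_convex k) U f.
Proof.
apply: uniform_of_bounded => [d f g d0 [Cf cf] [Cg cg]|g H].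
  split; first exact: sc_soft_max.
  apply: strongly_convex_soft_max => // x Ux.
    exact: (sc_continuous sX oU Cf Ux).
  exact: (sc_continuous sX oU Cg Ux).
by split; [apply: Ck_exhaustion|apply: strongly_convex_exhaustion] => n;
  have [h [Ch ch] gh] := H n; exists h.
Qed.

End Exhaustion.

End SmoothSpace.

(** * The three kinds of spaces *)

Section CkCalculus.
Context {R : realType}.
Implicit Types E F : normedModType R.

Lemma Ck_subset k E F (U V : set E) (f : E -> F) :
  V `<=` U -> Ck k U f -> Ck k V f.
Proof.
by case: k => [n|] VU Cf; [|move=> n]; apply: Cn_subset VU _; exact: Cf.
Qed.

Lemma Ck_continuous k E F (U : set E) (f : E -> F) x :
  Ck k U f -> U x -> {for x, continuous f}.
Proof. by case: k => [n|] Cf; [|have {}Cf := Cf 0%N]; exact: Cn_continuous Cf. Qed.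

Lemma CkD k E F (U : set E) (f g : E -> F) :
  Ck k U f -> Ck k U g -> Ck k U (fun x => f x + g x).
Proof. by case: k => [n|] Cf Cg; [|move=> n]; exact: CnD. Qed.

Lemma CkZ k E F (U : set E) (a : R) (f : E -> F) :
  Ck k U f -> Ck k U (fun x => a *: f x).
Proof. by case: k => [n|] Cf; [|move=> n]; exact: CnZ. Qed.

Lemma Ck_soft_pos k (d : R) E (U : set E) (f : E -> R^o) : 0 < d ->
  Ck k U f -> Ck k U (fun x => soft_pos d (f x) : R^o).
Proof. by case: k => [n|] d0 Cf; [|move=> n]; exact: Cn_soft_pos. Qed.

Lemma Ck_local k E F (U : set E) (f : E -> F) : open U ->
  (forall x, U x -> exists2 g, Ck k U g & {near x, f =1 g}) -> Ck k U f.
Proof.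
case: k => [n|] oU H; [|move=> n]; apply: Cn_local => // x /H[g Cg fg];
  by exists g.
Qed.

(** A straight line is an affine, hence differentiable, curve. *)
Lemma smooth_calculus_linear (V : normedModType R) (dist : V -> V -> \bar R) :
  smooth_calculus (@Defs.Space R V dist (@linear_geodesic R V)
    (fun k U f => @Ck R k V R^o U f)).
Proof.
split=> /=.
- by move=> k U W f; exact: Ck_subset.
- by move=> k U f x _; exact: Ck_continuous.
- by move=> k U f g; exact: CkD.
- by move=> k U a f; exact: CkZ.
- by move=> k U d f; exact: Ck_soft_pos.
- by move=> k U f; exact: Ck_local.
move=> U f a b c t oU [f' [df _]] [[x [v cE]] cU] Dt.
have near_c : {near (t : R^o), (fun s : R^o => x + s *: v) =1 c}.
  have : \forall s \near t, `]a, b[%classic s.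
    by apply: open_nbhs_nbhs; split=> //; exact: itv_open.
  by apply: filterS => s Ds; rewrite cE.
apply/derivable1_diffP.
have dc : differentiable (fun s : R^o => x + s *: v) t.
  apply: differentiableD => //; apply: differentiableZl => //.
have ct : c t = x + t *: v := cE t Dt.
have dft : differentiable (f : V -> R^o) (x + t *: v).
  by rewrite -ct; have [] := df (c t) (cU t Dt).
apply/derivable1_diffP.
apply: (@near_eq_derivable _ _ _ (f \o (fun s : R^o => x + s *: v))).
  by apply: filterS near_c => s /= ->.
apply/derivable1_diffP.
exact: differentiable_comp.
Qed.

End CkCalculus.

Section RiemannianCalculus.
Context {R : realType} (M : riemannian R).
Notation car := (rm_carrier M).
Notation H := (rm_model M).
Notation chart := (@rm_chart R M).
Notation chartV := (@rm_chartV R M).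
Notation dom := (@rm_dom R M).

(** Properties near a point of the manifold transfer to its coordinates by
    continuity of the inverse chart. *)
Lemma near_chartV i p (A : set car) : dom i p ->
  (\forall q \near p, A q) -> \forall y \near chart i p, A (chartV i y).
Proof.
by move=> Dp; rewrite -{1}(rm_chartK Dp); exact: rm_chartV_continuous.
Qed.

Lemma chart_image_open i (U : set car) : open U -> open (chart i @` (dom i `&` U)).
Proof.
move=> oU; rewrite openE => _ [p [Dp Up] <-].
have nU : \forall y \near chart i p, U (chartV i y).
  by apply: near_chartV => //; exact: open_nbhs_nbhs.
have nD : \forall y \near chart i p, (chart i @` dom i) y.
  apply: open_nbhs_nbhs; split; first exact: rm_range_open.
  by exists p.
rewrite /interior/=; near=> y.
have [q Dq qy] : (chart i @` dom i) y by near: y.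
exists q => //; split=> //; rewrite -(rm_chartK Dq) qy.
by near: y.
Unshelve. all: by end_near. Qed.

(** A function on the manifold is C^k when it is so in every chart, and the
    operations on functions commute with composition by a chart, so everything
    reduces to normed spaces.  A geodesic is a C^2 curve in the charts, which is
    all that differentiability along it requires. *)
Lemma smooth_calculus_riemannian : smooth_calculus (riemannian_space M).
Proof.
split=> /=.
- move=> k U V f VU Cf i; apply: Ck_subset (Cf i).
  by apply: image_subset => x [Dx /VU].
- move=> k U f p oU Cf Up; have Dp := rm_dom_at p.
  set i := rm_chart_at p in Dp.
  have fc : {for chart i p, continuous (f \o chartV i)}.
    by apply: Ck_continuous (Cf i) _; exists p.
  have : {for p, continuous ((f \o chartV i) \o chart i)}.
    by apply: continuous_comp; [exact: rm_chart_continuous|exact: fc].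
  rewrite /prop_for /continuous_at /= rm_chartK//; apply: cvg_trans.
  apply: near_eq_cvg.
  have : \forall q \near p, dom i q.
    by apply: open_nbhs_nbhs; split; [exact: rm_dom_open|exact: Dp].
  by apply: filterS => q Dq /=; rewrite rm_chartK.
- by move=> k U f g Cf Cg i; exact: CkD (Cf i) (Cg i).
- by move=> k U a f Cf i; exact: CkZ (Cf i).
- by move=> k U d f d0 Cf i; exact: Ck_soft_pos d0 (Cf i).
- move=> k U f oU Hf i; apply: Ck_local; first exact: chart_image_open.
  move=> _ [p [Dp Up] <-]; have [g Cg fg] := Hf p Up.
  by exists (g \o chartV i); [exact: Cg|exact: (near_chartV Dp fg)].
move=> U f a b c t oU Cf [[[cc cC] _] cU] Dt.
have Dct := rm_dom_at (c t); set i := rm_chart_at (c t) in Dct.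
have [c' [dc _]] := cC i; have [f' [df _]] := Cf i.
have dct : differentiable (chart i \o c : R^o -> H) t.
  by have [] := dc t (conj Dt Dct).
have dft : differentiable (f \o chartV i : H -> R^o) (chart i (c t)).
  have im : (chart i @` (dom i `&` U)) (chart i (c t)).
    by exists (c t) => //; split=> //; exact: cU.
  by have [] := df _ im.
apply: (@near_eq_derivable _ _ _ ((f \o chartV i) \o (chart i \o c))).
  have : \forall s \near t, dom i (c s).
    apply: (cc t Dt); apply: open_nbhs_nbhs.
    by split; [exact: rm_dom_open|exact: Dct].
  by apply: filterS => s Ds /=; rewrite rm_chartK.
by apply/derivable1_diffP; exact: differentiable_comp.
Qed.

End RiemannianCalculus.

Lemma smooth_calculus_ambient (R : realType) (X : ambient R) :
  smooth_calculus X.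
Proof.
case: X => [d|M _|E] /=; [|exact: smooth_calculus_riemannian|];
  exact: smooth_calculus_linear.
Qed.

Theorem theorem2 (R : realType) (X : ambient R) (U : set X) (k : smoothness)
    (B : nat -> set X) :
  open U -> gconvex_set U ->
  U = \bigcup_n B n ->
  (forall n, open (B n)) ->
  (forall n, bounded (B n)) ->
  (forall n, gconvex_set (B n)) ->
  (forall n, (0 < set_dist (B n) (frontier U))%E) ->
  (forall n, closure (B n) `<=` B n.+1) ->
  ((forall f : X -> R, continuous_convex U f ->
      approx_below_on_bounded (Ck_convex k) U f) ->
   forall f : X -> R, continuous_convex U f ->
     approx_below_uniformly (Ck_convex k) U f)
  /\
  ((forall f : X -> R, continuous_convex U f ->
      approx_below_on_bounded (Ck_strongly_convex k) U f) ->
   forall f : X -> R, continuous_convex U f ->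
     approx_below_uniformly (Ck_strongly_convex k) U f).
Proof.
move=> oU _ UB oB bB _ dB cB; have sX := smooth_calculus_ambient X.
split.
- exact: (Ck_convex_uniform sX oU UB oB bB dB cB).
- exact: (Ck_strongly_convex_uniform sX oU UB oB bB dB cB).
Qed.
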